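(* Let $(S,\Sigma,\delta)$ be an HMM with $\epsilon$-transitions such that from each state there is an outgoing path of non-zero probability containing a symbol in $\Sigma$. For an observation sequence $\widetilde{y}=a_1\dots a_n\in\Sigma^n$ and $s_0,s\in S$ with $V^{\widetilde{y}}_{s_0,s}>0$, let $\psi^{\widetilde{y}}_{s_0,s}$ denote a likeliest state sequence starting in $s_0$, ending in $s$ and explaining $\widetilde{y}$, i.e. $$\psi^{\widetilde{y}}_{s_0,s}=\operatorname{arg\,max}_{\widetilde{z}\in\Omega^n_{s_0},\ L(\widetilde{z})=s}P(Z=\widetilde{z}\land Y=\widetilde{y}).$$ Then $\psi^{\epsilon}_{s_0,s_0}=s_0$. Furthermore, whenever $n>0$, $\widetilde{y}=\widetilde{y}_1a_n$ and $V^{\widetilde{y}}_{s_0,s}>0$, $$\psi^{\widetilde{y}}_{s_0,s}=\psi^{\widetilde{y}_1}_{s_0,s'}\circ T\big(\mathcal{E}\mathit{Path}^{a_n}_{s',s}\big),\qquad\text{where } s'=\operatorname{arg\,max}_{s'\in S}V^{\widetilde{y}_1}_{s_0,s'}\cdot\mathcal{E}^{a_n}_{s',s}.$$ (Ties: for any maximizing $s'$, any maximizer $\psi^{\widetilde{y}_1}_{s_0,s'}$ and any likeliest sequence $\mathcal{E}\mathit{Path}^{a_n}_{s',s}$, the right-hand side is a maximizer in the definition of $\psi^{\widetilde{y}}_{s_0,s}$.)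
   Context: An HMM with $\epsilon$-transitions is a triple $(S,\Sigma,\delta)$ with a finite state space $S$, an alphabet $\Sigma$ (a finite set of observable symbols, with $\epsilon\notin\Sigma$) and a transition function $\delta\colon S\to\mathcal{D}((\Sigma\cup\{\epsilon\})\times S)$, where $\mathcal{D}(X)$ is the set of probability functions $P\colon X\to[0,1]$ with $\sum_{x}P(x)=1$. An outgoing path of $s$ of non-zero probability is a sequence $s=r_0,b_1,r_1,\dots,b_m,r_m$ with $r_i\in S$, $b_i\in\Sigma\cup\{\epsilon\}$ and $\delta(r_{i-1})(b_i,r_i)>0$ for all $i$; it contains a symbol in $\Sigma$ if some $b_i\in\Sigma$. For $s_0\in S$ and $n\in\mathbb{N}_0$, $\Omega^n_{s_0}=s_0((\epsilon S)^*\Sigma S)^n$ is the set of alternating sequences $\widetilde{z}=s_0a_1s_1\dots a_ms_m$ with $s_i\in S$, $a_i\in\Sigma\cup\{\epsilon\}$, exactly $n$ of the $a_i$ in $\Sigma$, and (if $n\ge1$) $a_m\in\Sigma$; $\Omega^0_{s_0}=\{s_0\}$. Its probability function is $P^n_{s_0}(\widetilde{z})=\prod_{i=1}^m\delta(s_{i-1})(a_i,s_i)$, with $P^0_{s_0}(s_0)=1$. Random variables on $\Omega^n_{s_0}$: $Z$ is the identity; $Y(\widetilde{z})\in\Sigma^n$ is the word of observable symbols of $\widetilde{z}$ (states and $\epsilon$'s removed); $L(\widetilde{z})\in S$ is the last state of $\widetilde{z}$. Thus $P(Z=\widetilde{z}\land Y=\widetilde{y})$ equals $P^n_{s_0}(\widetilde{z})$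 if $Y(\widetilde{z})=\widetilde{y}$ and $0$ otherwise, where $s_0$ is the first element of $\widetilde{z}$ and $n=|\widetilde{y}|$. As an observation sequence, $\epsilon$ denotes the empty word. $V^{\widetilde{y}}_{s_0,s}=\max_{\widetilde{z}\in\Omega^n_{s_0},\,L(\widetilde{z})=s}P(Z=\widetilde{z}\land Y=\widetilde{y})$ with $n=|\widetilde{y}|$ (the maximum over the empty set being $0$). For $a\in\Sigma$ and $r,s\in S$, $\mathcal{E}^a_{r,s}=\max_{\widetilde{z}\in\Omega^1_{r},\,L(\widetilde{z})=s}P(Z=\widetilde{z}\land Y=a)$. Whenever $\mathcal{E}^a_{r,s}>0$, $\mathcal{E}\mathit{Path}^a_{r,s}\in\Omega^1_r$ denotes a likeliest sequence starting in $r$, ending in $s$ and producing the observation $a$ in its last transition, i.e. one attaining the maximum $\mathcal{E}^a_{r,s}$. The operator $\circ$ is concatenation of sequences and $T$ removes the first element of a sequence. *)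

(* Defs.v *)
From HB Require Import structures.
From mathcomp Require Import all_boot all_order all_algebra.
From mathcomp Require Import boolp classical_sets reals.

Set Implicit Arguments.
Unset Strict Implicit.
Unset Printing Implicit Defensive.

Import Order.TTheory GRing.Theory Num.Theory.
Local Open Scope classical_set_scope.
Local Open Scope ring_scope.

Section Max.
Variables (R : realType) (T : Type).
Implicit Types (D : set T) (f : T -> R).

Definition argmax D f : set T :=
  [set x | D x /\ forall x', D x' -> f x' <= f x].

(* The value of [f] at its maximizers on [D]; it is 0 if there is none, in
   particular if [D] is empty.  Below [D] may be an infinite set of sequences,
   but when it is nonempty the maximum is attained: deleting an epsilon-loop
   never decreases the probability, and finitely many sequences with the
   required observation have no such loop. *)
Definition maxof D f : R := xget 0 [set f x | x in argmax D f].

End Max.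

Record distr (R : realType) (X : finType) := Distr {
  pmf :> X -> R;
  pmf_itv : forall x, 0 <= pmf x <= 1;
  pmf_sum : \sum_x pmf x = 1 }.

Section HMM.
Variables (R : realType) (S Sigma : finType).

(* A label is a symbol of [Sigma], or epsilon, encoded as [None]. *)
Definition step : Type := (option Sigma * S)%type.

(* The alternating sequence s_0 a_1 s_1 ... a_m s_m is encoded as
   (s_0, [:: (a_1, s_1); ...; (a_m, s_m)]). *)
Definition altseq : Type := (S * seq step)%type.

Definition observable (st : step) : bool := isSome st.1.

(* T(z): without its first element s_0, z is the sequence a_1 s_1 ... a_m s_m *)
Definition seqT (z : altseq) : seq step := z.2.

Definition seqcat (z : altseq) (w : seq step) : altseq := (z.1, z.2 ++ w).

Definition Yobs (z : altseq) : seq Sigma := pmap fst z.2.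

Definition Llast (z : altseq) : S := last z.1 (unzip2 z.2).

Definition Omega (n : nat) (s0 : S) : set altseq :=
  [set z | [/\ z.1 = s0, count observable z.2 = n &
    if n is 0 then z.2 = [::]
    else exists w a s, z.2 = rcons w (Some a, s)]].

Definition OmegaL (n : nat) (s0 s : S) : set altseq :=
  [set z | Omega n s0 z /\ Llast z = s].

Variable delta : S -> distr R (option Sigma * S)%type.

Fixpoint positive_steps (s : S) (w : seq step) : Prop :=
  if w is (b, r) :: w' then 0 < delta s (b, r) /\ positive_steps r w'
  else True.

Definition emits_symbol (s : S) : Prop :=
  exists w : seq step, positive_steps s w /\ has observable w.

Fixpoint steps_prob (s : S) (w : seq step) : R :=
  if w is (a, r) :: w' then delta s (a, r) * steps_prob r w' else 1.

Definition Pseq (z : altseq) : R := steps_prob z.1 z.2.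

(* P(Z = z /\ Y = y) *)
Definition PZY (y : seq Sigma) (z : altseq) : R :=
  if Yobs z == y then Pseq z else 0.

Definition V (y : seq Sigma) (s0 s : S) : R :=
  maxof (OmegaL (size y) s0 s) (PZY y).

(* The set of all likeliest state sequences, that is of all possible values of
   psi^y_{s0,s}; it is meant to be used when [0 < V y s0 s]. *)
Definition psi (y : seq Sigma) (s0 s : S) : set altseq :=
  argmax (OmegaL (size y) s0 s) (PZY y).

Definition Emax (a : Sigma) (r s : S) : R :=
  maxof (OmegaL 1 r s) (PZY [:: a]).

(* Likewise, all possible values of EPath^a_{r,s}, for [0 < Emax a r s] *)
Definition EPath (a : Sigma) (r s : S) : set altseq :=
  argmax (OmegaL 1 r s) (PZY [:: a]).

End HMM.

(* Main.v *)
Require Import Defs.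
From HB Require Import structures.
From mathcomp Require Import all_boot all_order all_algebra.
From mathcomp Require Import boolp classical_sets reals.

Set Implicit Arguments.
Unset Strict Implicit.
Unset Printing Implicit Defensive.

Import Order.TTheory GRing.Theory Num.Theory.
Local Open Scope classical_set_scope.
Local Open Scope ring_scope.

(** Cut a likeliest sequence for y_1 a just after its last symbol before the
    final one.  The probability is the product of those of the two pieces, so
    each piece is a likeliest sequence between its own endpoints: a better one
    could be substituted.  Hence the maxima V and E at the cut state r are
    attained by these pieces, and V_{s0,s'} E_{s',s} >= V_{s0,r} E_{r,s} is at
    least the maximal probability.  Since that probability is positive, this
    exchange argument yields all the attainment that is needed, with no
    epsilon-loop deletion. *)

Section Maxof.
Variables (R : realType) (T : Type).
Implicit Types (D : set T) (f : T -> R).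

(** Two maximizers bound each other's values, so the choice made by [xget] does not matter. *)
Lemma maxof_argmax D f x : argmax D f x -> maxof D f = f x.
Proof.
move=> fx; rewrite /maxof; case: xgetP => [y _ [x' fx' <-]|/(_ (f x))].
  by apply/eqP; rewrite eq_le fx.2 ?fx'.2 //; [exact: fx.1|exact: fx'.1].
by case; exists x.
Qed.

(** A positive value cannot be the default 0 of [xget], so it comes from a maximizer. *)
Lemma maxof_gt0_argmax D f : 0 < maxof D f -> exists x, argmax D f x.
Proof.
rewrite /maxof; case: xgetP => [y _ [x fx _] _|_]; first by exists x.
by rewrite ltxx.
Qed.

Lemma maxof_ge0 D f : (forall x, 0 <= f x) -> 0 <= maxof D f.
Proof. by move=> f0; rewrite /maxof; case: xgetP => // y _ [x _ <-]. Qed.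

End Maxof.

Section Sequences.
Variables (R : realType) (S Sigma : finType).
Variable delta : S -> distr R (option Sigma * S)%type.
Local Notation observable := (@observable S Sigma).
Implicit Types (s r : S) (w u v : seq (step S Sigma)) (z : altseq S Sigma).
Implicit Types (y : seq Sigma) (a : Sigma) (n : nat).

(** The default [true] admits the empty sequence, so that one condition serves both cases of
    [Omega]. *)
Definition ends_observable w := last true (map observable w).

(** Induction from the right: an observable step resets [v] to the empty sequence, an epsilon step
    is appended to it. *)
Lemma ends_observable_split w :
  exists u v, [/\ w = u ++ v, ends_observable u & count observable v = 0%N].
Proof.
elim/last_ind: w => [|w x [u [v [-> eu cv]]]]; first by exists [::], [::].
case ox: (observable x).
  exists (rcons (u ++ v) x), [::]; split=> //; first by rewrite cats0.
  by rewrite /ends_observable map_rcons last_rcons.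
exists u, (rcons v x); split=> //; first by rewrite rcons_cat.
by rewrite -cats1 count_cat cv /= ox.
Qed.

Lemma OmegaP n s z :
  Omega n s z <-> [/\ z.1 = s, count observable z.2 = n & ends_observable z.2].
Proof.
case: z => s1 w; split=> -[/= -> cw ew]; split=> //.
  case: n cw ew => [_ ->//|n _ [w' [a [t ->]]]].
  by rewrite /ends_observable map_rcons last_rcons.
elim/last_ind: w cw ew => [<- //|w [[a|] t] _].
  by rewrite -cats1 count_cat addn1 => <- _; exists w, a, t; rewrite cats1.
by rewrite /ends_observable map_rcons last_rcons.
Qed.

Lemma size_Yobs z : size (Yobs z) = count observable z.2.
Proof. by rewrite size_pmap. Qed.

Lemma Llast_seqcat z w : Llast (seqcat z w) = Llast (Llast z, w).
Proof. by rewrite /Llast /= /unzip2 map_cat last_cat. Qed.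

Lemma Omega_seqcat n m s z w : Omega n s z -> Omega m.+1 (Llast z) (Llast z, w) ->
  Omega (n + m.+1) s (seqcat z w).
Proof.
move=> /OmegaP[z1 cz ez] /OmegaP[/= _ cw ew]; apply/OmegaP; split=> //=.
  by rewrite count_cat cz cw.
rewrite /ends_observable map_cat last_cat.
(* The count [m.+1] forces [w] to be nonempty, so the default given to [last] is irrelevant. *)
by case: w cw ew => // x w.
Qed.

Lemma Omega_split n s z : Omega n.+1 s z ->
  exists z1 w, [/\ z = seqcat z1 w, Omega n s z1 &
    Omega 1 (Llast z1) (Llast z1, w)].
Proof.
case: z => s1 z2 [/= -> cz [w [a [t zE]]]]; subst z2.
(* With the final symbol set aside, [u] ends at the cut; the epsilon run [v] followed by that symbol
   is the second piece. *)
have [u [v [wE eu cv]]] := ends_observable_split w; subst w.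
move: cz; rewrite -cats1 !count_cat cv addn0 addn1 => -[cu].
exists (s, u), (v ++ [:: (Some a, t)]); rewrite /seqcat /= -catA; split=> //.
  exact/OmegaP.
apply/OmegaP; split=> //=; first by rewrite count_cat cv.
by rewrite /ends_observable map_cat last_cat.
Qed.

Lemma steps_prob_ge0 s w : 0 <= steps_prob delta s w.
Proof.
elim: w s => [|[a r] w IHw] s //=.
by rewrite mulr_ge0 //; have /andP[] := pmf_itv (delta s) (a, r).
Qed.

Lemma Pseq_seqcat z w :
  Pseq delta (seqcat z w) = Pseq delta z * Pseq delta (Llast z, w).
Proof.
case: z => s u; rewrite /Pseq /Llast /=.
by elim: u s => [|[a r] u IHu] s /=; rewrite ?mul1r // IHu mulrA.
Qed.

Lemma PZY_ge0 y z : 0 <= PZY delta y z.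
Proof. by rewrite /PZY; case: ifP => // _; apply: steps_prob_ge0. Qed.

(** Since [z] emits exactly [size y] symbols, equality of the concatenated words splits into
    equality of both parts. *)
Lemma PZY_seqcat y y' s z w : Omega (size y) s z ->
  PZY delta (y ++ y') (seqcat z w) = PZY delta y z * PZY delta y' (Llast z, w).
Proof.
move=> /OmegaP[_ cz _]; rewrite /PZY Pseq_seqcat /Yobs /= pmap_cat.
rewrite eqseq_cat; last by have := size_Yobs z; rewrite cz.
by case: (_ == y); case: (_ == y'); rewrite /= ?mulr0 ?mul0r.
Qed.

Lemma V_ge0 y s r : 0 <= V delta y s r.
Proof. by apply: maxof_ge0 => z; apply: PZY_ge0. Qed.

Lemma Emax_ge0 a s r : 0 <= Emax delta a s r.
Proof. by apply: maxof_ge0 => z; apply: PZY_ge0. Qed.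

Lemma OmegaL_seqcat n s r t z w : OmegaL n s r z -> OmegaL 1 r t (r, w) ->
  OmegaL n.+1 s t (seqcat z w).
Proof.
move=> [Oz zr] [Ow wt]; subst r; split; last by rewrite Llast_seqcat.
by rewrite -addn1; apply: Omega_seqcat.
Qed.

Lemma OmegaL0 s : OmegaL 0 s s = [set ((s, [::]) : altseq S Sigma)].
Proof.
apply/seteqP; split=> [[s1 w] [[/= -> _ ->] _] //|_ ->].
by split=> //; split.
Qed.

Lemma psi_nil s : psi delta [::] s s = [set (s, [::])].
Proof.
rewrite /psi OmegaL0; apply/seteqP; split=> [z [] //|z /= zE].
by split=> // _ ->; rewrite zE.
Qed.

Lemma V_nil s : V delta [::] s s = 1.
Proof.
have sP : psi delta [::] s s (s, [::]) by rewrite psi_nil.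
by rewrite /V (maxof_argmax sP) /PZY eqxx.
Qed.

Lemma psi_rcons_split y a s t z : psi delta (rcons y a) s t z ->
  0 < PZY delta (rcons y a) z ->
  exists r, PZY delta (rcons y a) z = V delta y s r * Emax delta a r t.
Proof.
rewrite -cats1 /psi size_cat addn1 => -[[Oz zt] zmax].
have [z1 [w [zE Oz1 Ow]]] := Omega_split Oz; subst z.
rewrite (PZY_seqcat _ _ Oz1) => Pgt0.
(* Strict positivity of both factors lets either one be cancelled in the exchange below. *)
have Pz1 : 0 < PZY delta y z1.
  by rewrite lt_def PZY_ge0 andbT; apply: contraTneq Pgt0 => ->; rewrite mul0r ltxx.
have Pw : 0 < PZY delta [:: a] (Llast z1, w) by rewrite -(pmulr_rgt0 _ Pz1).
have OLw : OmegaL 1 (Llast z1) t (Llast z1, w) by split; rewrite -?Llast_seqcat.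
exists (Llast z1); congr (_ * _); apply/esym/maxof_argmax; split=> //.
  (* A competitor [z'] for the first piece is extended by the same [w] and compared with the whole
     maximizer; the second piece is treated symmetrically. *)
  move=> z' Oz'; rewrite -(ler_pM2r Pw).
  have /zmax := OmegaL_seqcat Oz' OLw.
  by rewrite (PZY_seqcat _ _ Oz'.1) (PZY_seqcat _ _ Oz1) Oz'.2.
move=> [r w'] OLw'; have rE : r = Llast z1 by case: OLw' => -[].
rewrite rE in OLw' *; rewrite -(ler_pM2l Pz1) -!(PZY_seqcat _ _ Oz1).
exact/zmax/(OmegaL_seqcat _ OLw').
Qed.

End Sequences.

Theorem propositionB1 (R : realType) (S Sigma : finType)
    (delta : S -> distr R (option Sigma * S)%type)
    (hdelta : forall s : S, emits_symbol delta s) :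
  (forall s0 : S,
     0 < V delta [::] s0 s0 /\ psi delta [::] s0 s0 = [set (s0, [::])]) /\
  (forall (y1 : seq Sigma) (a : Sigma) (s0 s : S),
     0 < V delta (rcons y1 a) s0 s ->
     forall s' : S,
       argmax [set: S] (fun r : S => V delta y1 s0 r * Emax delta a r s) s' ->
       [/\ 0 < V delta y1 s0 s',
           0 < Emax delta a s' s &
           forall z e : altseq S Sigma,
             psi delta y1 s0 s' z ->
             EPath delta a s' s e ->
             psi delta (rcons y1 a) s0 s (seqcat z (seqT e))]).
Proof.
split=> [s0|y a s0 s Vgt0 s' [_ s'max]]; first by rewrite V_nil psi_nil.
have [zm zmP] := maxof_gt0_argmax Vgt0.
move: Vgt0; rewrite /V (maxof_argmax zmP) => Pgt0.
have [r PE] := psi_rcons_split zmP Pgt0.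
have Ple : PZY delta (rcons y a) zm <= V delta y s0 s' * Emax delta a s' s.
  by rewrite PE; apply: s'max.
have VEgt0 := lt_le_trans Pgt0 Ple.
have V0 : 0 < V delta y s0 s'.
  by rewrite lt_def V_ge0 andbT; apply: contraTneq VEgt0 => ->; rewrite mul0r ltxx.
split=> //; first by rewrite -(pmulr_rgt0 _ V0).
(* The first state of [e], which [seqT] removes, is the last state [s'] of [z]. *)
move=> z [e1 w] zP eP; have e1E : e1 = s' by case: eP => -[[]].
subst e1; split=> [|x xP].
  by rewrite size_rcons; apply: OmegaL_seqcat zP.1 eP.1.
(* Any competitor [x] is bounded by [zm], hence by the product of maxima at [s'], which is the
   probability of the concatenation. *)
apply: le_trans (zmP.2 _ xP) _; apply: le_trans Ple _.
rewrite /V /Emax (maxof_argmax zP) (maxof_argmax eP) -cats1.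
by rewrite (PZY_seqcat _ _ _ zP.1.1) zP.1.2.
Qed.
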